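(* Let $k\ge 1$ and $r\ge1$ be integers. The generating function $\sum_{\pi} x^{|\pi|}$, where the sum is over all $132$-avoiding permutations $\pi$ with exactly $r$ occurrences of the pattern $12\dots k$, is given by $$\sum \left(\prod_{i\ge1}\binom{\ell_i+\ell_{i+1}-1}{\ell_{i+1}}\right)\frac{\left(U_{k-1}\left(\frac{1}{2\sqrt x}\right)\right)^{\ell_1-1}}{\left(U_{k}\left(\frac{1}{2\sqrt x}\right)\right)^{\ell_1+1}}\,x^{\frac12(\ell_1-1)+(\ell_2+\ell_3+\cdots)},$$ where the outer sum is over all sequences of nonnegative integers $\ell_1,\ell_2,\dots$ satisfying $$\ell_1\binom{k-1}{k-1}+\ell_2\binom{k}{k-1}+\ell_3\binom{k+1}{k-1}+\cdots=r .$$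
   Context: For a permutation $\pi=\pi_1\cdots\pi_n$ of $\{1,\dots,n\}$ and a permutation $\sigma=\sigma_1\cdots\sigma_m$ of $\{1,\dots,m\}$, an occurrence of the pattern $\sigma$ in $\pi$ is a choice of indices $i_1<\dots<i_m$ such that $\pi_{i_1}\cdots\pi_{i_m}$ is in the same relative order as $\sigma$; $\pi$ is $\sigma$-avoiding if there is no occurrence. $|\pi|=n$ denotes the number of elements permuted by $\pi$ (the empty permutation is included, with $|\pi|=0$). $U_n$ denotes the $n$-th Chebyshev polynomial of the second kind, $U_n(\cos t)=\sin((n+1)t)/\sin t$. In the product of binomial coefficients, factors with $\ell_i=\ell_{i+1}=0$ are equal to $1$ (so the product is effectively finite); only finitely many $\ell_i$ can be nonzero, so the sum is finite. *)

(* Defs.v *)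
From mathcomp Require Import all_boot all_order all_algebra all_fingroup.
From mathcomp Require Import finmap.
From mathcomp Require Import boolp classical_sets functions cardinality fsbigop.
From mathcomp Require Import reals trigo.

Set Implicit Arguments.
Unset Strict Implicit.
Unset Printing Implicit Defensive.

Import Order.TTheory GRing.Theory Num.Theory.

Local Open Scope ring_scope.
Local Open Scope classical_set_scope.

Definition occurrences (m n : nat) (sigma : 'S_m) (pi : 'S_n) :
    {set {ffun 'I_m -> 'I_n}} :=
  [set f : {ffun 'I_m -> 'I_n} |
    [forall a : 'I_m, forall b : 'I_m, (a < b)%N ==> (f a < f b)%N] &&
    [forall a : 'I_m, forall b : 'I_m,
        (pi (f a) < pi (f b))%N == (sigma a < sigma b)%N]]%SET.

Definition avoids (m n : nat) (sigma : 'S_m) (pi : 'S_n) : bool :=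
  occurrences sigma pi == finset.set0.

(* Positions and values are numbered from 0, so 132 is the word 0 2 1. *)
Definition pattern132 : 'S_3 := tperm (inord 1) (inord 2).

Lemma pattern132E :
  [/\ pattern132 (inord 0) = inord 0, pattern132 (inord 1) = inord 2
    & pattern132 (inord 2) = inord 1].
Proof.
rewrite /pattern132 tpermL tpermR; split => //.
by rewrite tpermD // -val_eqE /= !inordK.
Qed.

Definition increasing_pattern (k : nat) : 'S_k := 1%g.

Definition num_av132 (k r n : nat) : nat :=
  #|[set pi : 'S_n | avoids pattern132 pi &
      #|occurrences (increasing_pattern k) pi| == r]%SET|.

Fixpoint chebU (R : nzRingType) (n : nat) : {poly R} :=
  match n with
  | 0 => 1
  | n'.+1 => match n' with
             | 0 => 'X *+ 2
             | n''.+1 => 'X *+ 2 * chebU R n' - chebU R n''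
             end
  end.

Lemma chebUSS (R : nzRingType) n :
  chebU R n.+2 = 'X *+ 2 * chebU R n.+1 - chebU R n.
Proof. by []. Qed.

Lemma chebU_cos (R : realType) n (t : R) : sin t != 0 ->
  (chebU R n).[cos t] = sin (n.+1%:R * t) / sin t.
Proof.
move=> st0; apply: (canRL (mulfK st0)).
suff: (chebU R n).[cos t] * sin t = sin (n.+1%:R * t) /\
      (chebU R n.+1).[cos t] * sin t = sin (n.+2%:R * t) by case.
elim: n => [|n [IH1 IH2]].
  rewrite /= hornerC !mul1r; split => //.
  by rewrite hornerMn hornerX mulr_natl sin_mulr2n mulrnAl.
split=> //; rewrite chebUSS hornerD hornerN hornerM hornerMn hornerX.
rewrite mulrBl -mulrA IH1 IH2.
have -> : n.+3%:R * t = n.+2%:R * t + t by rewrite -natr1 mulrDl mul1r.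
have -> : n.+1%:R * t = n.+2%:R * t - t by rewrite -[in RHS]natr1 mulrDl mul1r addrK.
rewrite !sinD sinN cosN mulr2n mulrDl mulrN opprD opprK [cos t * _]mulrC.
by rewrite addrA -[_ + _ - _]addrA subrr addr0.
Qed.

(* The field Q(sqrt x), as rational functions in the indeterminate sqrt x. *)
Notation ratfun := {fraction {poly rat}}.

Definition sqrtx : ratfun := FracField.tofrac 'X.
Definition xvar : ratfun := sqrtx ^+ 2.

Definition U_at (k : nat) : ratfun := (chebU ratfun k).[(2%:R * sqrtx)^-1].

(* The sequence ell_1, ell_2, ... is encoded as l : nat -> nat with
   l i = ell_(i+1). *)
Definition admissible (k r : nat) : set (nat -> nat) :=
  [set l | finite_set [set i | l i != 0%N] /\
    (\big[addn/0]_(i \in [set: nat]) (l i * 'C(k.-1 + i, k.-1)) = r)%N].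

(* The subtraction is truncated only when l i = l i.+1 = 0, and then the
   factor is 'C(0, 0) = 1, as the stated convention requires.  If l i = 0 and
   l i.+1 > 0, the factor is 0. *)
Definition binom_prod (l : nat -> nat) : nat :=
  (\big[muln/1]_(i \in [set: nat]) 'C(l i + l i.+1 - 1, l i.+1))%N.

Definition tail_sum (l : nat -> nat) : nat :=
  (\big[addn/0]_(i \in [set: nat]) l i.+1)%N.

(* For k = 1 the set [admissible k r] is infinite, but a summand is nonzero only
   if the support of l is an initial segment of nat, so the finitely supported
   sum over [admissible k r] is the intended one for every k >= 1. *)
Definition summand (k : nat) (l : nat -> nat) : ratfun :=
  (binom_prod l)%:R
  * (U_at k.-1 ^ ((l 0%N)%:Z - 1) / U_at k ^+ (l 0%N).+1)
  * (sqrtx ^ ((l 0%N)%:Z - 1) * xvar ^+ tail_sum l).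

(* The formal power series sum_m f m * (sqrt x)^m, multiplied by q, equals p;
   as Q[[sqrt x]] is a domain this determines f from F = p / q and does not
   depend on the choice of p and q. *)
Definition is_expansion (f : nat -> rat) (F : ratfun) : Prop :=
  exists p q : {poly rat},
    [/\ q != 0, F = FracField.tofrac p / FracField.tofrac q
      & forall n, \sum_(i < n.+1) q`_i * f (n - i)%N = p`_n].

(* The series sum_n a n * x^n, as a series in sqrt x. *)
Definition series_in_x (a : nat -> nat) (m : nat) : rat :=
  if odd m then 0 else (a m./2)%:R.

(* Main.v *)
From HB Require Import structures.
Require Import Defs.
From mathcomp Require Import all_boot all_order all_algebra all_fingroup.
From mathcomp Require Import zify ring.

Set Implicit Arguments.
Unset Strict Implicit.
Unset Printing Implicit Defensive.

(** A 132-avoiding perm_seq splits at its maximum as [u M v] with every letter of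
    [u] above every letter of [v], so such words are the binary trees, equivalently
    the plane forests, and an increasing subsequence lies in [u], in [u M] or in
    [v].  Hence the occurrences of 12...k are counted by the sum of
    [C(depth, k-1)] over the nodes of the forest, and the generating functions
    [P_d] of forests rooted at depth [d] satisfy
    [P_d = 1 / (1 - x q^C(d,k-1) P_(d+1))].  Unfolding the first [k] levels, where
    only the last one involves [q], writes [P_0] as a ratio of convergents, which
    are Chebyshev polynomials, in [z = x q P_k]; the coefficient of [q^r] then
    only involves [z, ..., z^r].  Expanding the powers of [P_k] level by level
    with the negative binomial series gives the product of binomials. *)

(** * Increasing subsequences and 132-avoiding words *)

(** Subwords are listed once per set of positions, so counting them counts choices of positions. *)
Fixpoint subseqs (T : Type) (w : seq T) : seq (seq T) :=
  if w is x :: w' then map (cons x) (subseqs w') ++ subseqs w' else [:: [::]].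

Lemma map_subseqs (T T' : Type) (f : T -> T') w :
  map (map f) (subseqs w) = subseqs (map f w).
Proof. by elim: w => //= x w IH; rewrite map_cat -IH -!map_comp. Qed.

Lemma mem_subseqs (T : eqType) (s w : seq T) : (s \in subseqs w) = subseq s w.
Proof.
elim: w s => [|x w IH] s /=; first by rewrite inE; case: s.
rewrite mem_cat IH; case: s => [|y s]; first by rewrite sub0seq orbT.
case: eqP => [->|nyx].
  rewrite mem_map ?IH; last by move=> ? ? [].
  case: (boolP (subseq s w)) => //= /negP H.
  by apply/negP => /(subseq_trans (subseq_cons _ _)).
by case: mapP => // -[s' _ [/nyx]].
Qed.

Lemma uniq_subseqs (T : eqType) (w : seq T) : uniq w -> uniq (subseqs w).
Proof.
elim: w => //= x w IH /andP[xw uw].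
rewrite cat_uniq IH // andbT map_inj_uniq ?IH //; last by move=> ? ? [].
apply/hasPn => s; rewrite mem_subseqs => sw; apply/mapP => -[s' _ es].
by move/negP: xw; apply; apply: (mem_subseq sw); rewrite es mem_head.
Qed.

Lemma count_subseqs_filter (T : eqType) (c : pred T) (P : pred (seq T)) w :
  (forall s, P s -> all c s) ->
  count P (subseqs w) = count P (subseqs (filter c w)).
Proof.
elim: w P => //= x w IH P Pc; rewrite count_cat count_map.
case: ifP => cx /=.
  by rewrite count_cat count_map -!IH // => s /Pc /= /andP[].
rewrite -IH // -[RHS]add0n; congr (_ + _).
by apply/eqP; rewrite -leqn0 leqNgt -has_count; apply/hasP => -[s _ /Pc /=]; rewrite cx.
Qed.

Lemma count_subseqs_rcons (T : Type) (P : pred (seq T)) w x :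
  count P (subseqs (rcons w x)) =
  count P (subseqs w) + count (fun s => P (rcons s x)) (subseqs w).
Proof.
elim: w P => [|y w IH] P /=; first by rewrite !addn0 addnC.
rewrite !count_cat !count_map !IH; set a := count _ _; set b := count _ _.
by rewrite /= addnACA.
Qed.

Definition incr_count (m : nat) (w : seq nat) : nat :=
  count (fun s => (size s == m) && sorted ltn s) (subseqs w).

Lemma incr_count0 w : incr_count 0 w = 1.
Proof.
elim: w => //= x w IH; rewrite /incr_count /= count_cat count_map -/(incr_count 0 w) IH addn1.
by congr _.+1; apply/eqP; rewrite -leqn0 leqNgt -has_count; apply/hasP => -[].
Qed.

(** No increasing subsequence meets both [u] and [v]. The length is taken positive because the empty
    subsequence would be counted twice on the right. *)
Lemma incr_count_cat m u v : {in u & v, forall a c, c < a} ->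
  incr_count m.+1 (u ++ v) = incr_count m.+1 u + incr_count m.+1 v.
Proof.
elim: u => [|a u IH] h; first by rewrite /= /incr_count /=.
rewrite /incr_count /= !count_cat !count_map -!/(incr_count _ _) IH ?addnA; last first.
  by move=> x c xu cv; apply: h => //; rewrite inE xu orbT.
(* Whatever follows the first letter [a] must exceed [a], and no letter of [v] does. *)
congr (_ + _ + _).
rewrite [LHS](count_subseqs_filter (c := ltn a)); last first.
  by move=> s /= /andP[_]; rewrite (path_sortedE ltn_trans) => /andP[].
rewrite [RHS](count_subseqs_filter (c := ltn a)); last first.
  by move=> s /= /andP[_]; rewrite (path_sortedE ltn_trans) => /andP[].
rewrite filter_cat; suff -> : filter (ltn a) v = [::] by rewrite cats0.
apply/eqP; rewrite -[_ == _]negbK -has_filter; apply/hasPn => c cv /=.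
by rewrite -leqNgt ltnW // h // mem_head.
Qed.

Lemma incr_count_rcons m u M : {in u, forall a, a < M} ->
  incr_count m.+1 (rcons u M) = incr_count m.+1 u + incr_count m u.
Proof.
move=> h; rewrite /incr_count count_subseqs_rcons; congr (_ + _).
apply: eq_in_count => s; rewrite mem_subseqs => su; rewrite size_rcons eqSS.
congr (_ && _); case: s su => // x s su /=; rewrite rcons_path.
apply/andb_idr => _; apply: h; apply: (mem_subseq su); exact: mem_last.
Qed.

(** * Binary trees and their words *)

Inductive btree := Leaf | Node of btree & btree.

Lemma btree_comparable : comparable btree.
Proof. by rewrite /comparable /decidable; decide equality. Qed.

HB.instance Definition _ := hasDecEq.Build btree (compareP btree_comparable).

Fixpoint nodes t := if t is Node l r then (nodes l + nodes r).+1 else 0.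

(* The root of [Node l r] is the maximum; [b] is the smallest letter. *)
Fixpoint tree_word b t : seq nat :=
  if t is Node l r then
    tree_word (b + nodes r) l ++ (b + (nodes l + nodes r)) :: tree_word b r
  else [::].

Lemma size_tree_word b t : size (tree_word b t) = nodes t.
Proof.
by elim: t b => //= l IHl r IHr b; rewrite size_cat /= IHl IHr addnS.
Qed.

Lemma perm_tree_word b t : perm_eq (tree_word b t) (iota b (nodes t)).
Proof.
elim: t b => //= l IHl r IHr b.
have -> : b :: iota b.+1 (nodes l + nodes r) = iota b (nodes l + nodes r).+1 by [].
rewrite -addn1 iotaD /= [nodes l + _]addnC perm_catC perm_sym perm_catC perm_sym.
by rewrite /= perm_cons iotaD perm_cat.
Qed.

Lemma mem_tree_word b t x : (x \in tree_word b t) = (b <= x < b + nodes t).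
Proof. by rewrite (perm_mem (perm_tree_word b t)) mem_iota. Qed.

(* Read [Node l r] as a plane forest whose first root has the children [l] and
   the right siblings [r]; [d] is the depth of the roots. *)
Fixpoint tree_weight m d t :=
  if t is Node l r then 'C(d, m) + tree_weight m d.+1 l + tree_weight m d r else 0.

Lemma tree_weight0 d t : tree_weight 0 d.+1 t = tree_weight 0 d t.
Proof. by elim: t d => //= l IHl r IHr d; rewrite !bin0 IHl IHr. Qed.

Lemma tree_weightS m d t : tree_weight m.+1 d.+1 t = tree_weight m.+1 d t + tree_weight m d t.
Proof. by elim: t d => //= l IHl r IHr d; rewrite binS IHl IHr; lia. Qed.

(** Appending the maximum to increasing subsequences of the left word adds the count for one length
    less; by Pascal's rule, [tree_weightS], this moves the left subtree one level down. For [m = 0]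
    the maximum alone gives the term [C(0, 0)]. *)
Lemma incr_count_tree_word m b t : incr_count m.+1 (tree_word b t) = tree_weight m 0 t.
Proof.
elim: t m b => [|l IHl r IHr] m b /=; first by rewrite /incr_count /=.
rewrite -cat_rcons incr_count_cat; last first.
  move=> a c; rewrite mem_rcons inE !mem_tree_word; lia.
rewrite incr_count_rcons; last by move=> a; rewrite mem_tree_word; lia.
rewrite !IHl IHr; congr (_ + _); case: m => [|m].
  by rewrite incr_count0 bin0 tree_weight0 addnC.
by rewrite IHl bin0n /= tree_weightS.
Qed.

Definition av132 (w : seq nat) := forall i j l, i < j -> j < l -> l < size w ->
  ~~ (nth 0 w i < nth 0 w l < nth 0 w j).

(** If the last letter of an occurrence lies in the left word, so do the others; it cannot be the
    maximum; if it lies in the right word, the first letter, being smaller, lies there too.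
    Induction excludes the two remaining cases. *)
Lemma av132_tree_word b t : av132 (tree_word b t).
Proof.
elim: t b => [|l IHl r IHr] b //= i j h ij jh.
rewrite size_cat /= !nth_cat !size_tree_word => hs.
have [hl|] := ltnP h (nodes l).
  rewrite !(ltn_trans _ hl) ?(ltn_trans ij) //.
  by apply: IHl => //; rewrite size_tree_word.
rewrite leq_eqVlt => /orP[/eqP eh|lh].
  have jl : j < nodes l by lia.
  rewrite -eh subnn /= jl; have := mem_nth 0 (s := tree_word (b + nodes r) l) (n := j).
  by rewrite size_tree_word mem_tree_word => /(_ jl); move: (nth _ _ _) (nth _ _ _) => p q; lia.
have Eh : h - nodes l = (h - (nodes l).+1).+1 by lia.
have hr : h - (nodes l).+1 < nodes r by lia.
rewrite Eh /=; have := mem_nth 0 (s := tree_word b r) (n := h - (nodes l).+1).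
rewrite size_tree_word mem_tree_word => /(_ hr) hb.
case: (ltngtP i (nodes l)) => il.
- have := mem_nth 0 (s := tree_word (b + nodes r) l) (n := i).
  rewrite size_tree_word mem_tree_word => /(_ il); move: hb.
  by move: (nth 0 (tree_word b r) _) (nth 0 (tree_word _ l) i) => p q; lia.
- have -> : (j < nodes l) = false by lia.
  have -> : i - nodes l = (i - (nodes l).+1).+1 by lia.
  have -> : j - nodes l = (j - (nodes l).+1).+1 by lia.
  by apply: IHr; rewrite ?size_tree_word; lia.
- by move: hb; rewrite il subnn /=; move: (nth 0 (tree_word b r) _) => p; lia.
Qed.

Lemma cat_cons_inj (T : eqType) (x : T) u u' v v' :
  x \notin u -> x \notin u' -> u ++ x :: v = u' ++ x :: v' -> u = u' /\ v = v'.
Proof.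
move=> xu xu' E; have : index x (u ++ x :: v) = index x (u' ++ x :: v') by rewrite E.
rewrite !index_cat (negPf xu) (negPf xu') /= eqxx !addn0 => es.
by move/eqP: E; rewrite eqseq_cat // eqseq_cons eqxx /= => /andP[/eqP-> /eqP->].
Qed.

Lemma tree_word_inj b : injective (tree_word b).
Proof.
move=> t t'; elim: t b t' => [|l IHl r IHr] b [|l' r'] //= E.
- by move/(congr1 size): E; rewrite size_cat /= addnS.
- by move/(congr1 size): E; rewrite size_cat /= addnS.
have en : nodes l + nodes r = nodes l' + nodes r'.
  by move/(congr1 size): E; rewrite !size_cat /= !size_tree_word !addnS => -[].
move: E; rewrite en => /cat_cons_inj[]; try by rewrite mem_tree_word; lia.
move=> El Er; rewrite (IHr _ _ Er); congr Node.
(* The left words start from [b + nodes r] and [b + nodes r']; the induction hypothesis needs these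
   bases to agree. *)
move/(congr1 size): (Er); rewrite !size_tree_word => er.
by move: El; rewrite er => /IHl.
Qed.

(** The maximum cuts [w] into [u] and [v]. Avoidance puts [u] above [v], so [v] fills the lower and
    [u] the upper part of the interval, and both come from trees by induction. *)
Lemma tree_word_surj n b w : perm_eq w (iota b n) -> av132 w ->
  exists2 t, nodes t = n & w = tree_word b t.
Proof.
elim/ltn_ind: n b w => -[|n] IH b w pw aw.
  by exists Leaf => //; apply/eqP; rewrite -size_eq0 (perm_size pw).
have Mw : b + n \in w by rewrite (perm_mem pw) mem_iota; lia.
have uw : uniq w by rewrite (perm_uniq pw) iota_uniq.
have [u [v Ew]] : exists u v, w = u ++ b + n :: v.
  by case/splitPr: Mw => u v; exists u, v.
have puv : perm_eq (u ++ v) (iota b n).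
  rewrite -(perm_cons (b + n)); apply: (perm_trans (y := w)).
    by rewrite Ew perm_sym perm_catC /= perm_cons perm_catC.
  by apply: (perm_trans pw); rewrite -addn1 iotaD perm_catC.
have uv : {in u & v, forall a c, c < a}.
  move=> a c au cv; rewrite ltnNge leq_eqVlt; apply/negP => /orP[/eqP eac|ac].
    move: uw; rewrite Ew cat_uniq => /and3P[_ /hasPn /(_ a)].
    by rewrite inE eac cv orbT -eac au => /(_ isT).
  (* If [a < c], then [a], the maximum and [c] form an occurrence of 132. *)
  have := aw (index a u) (size u) ((size u).+1 + index c v).
  have iu : index a u < size u by rewrite index_mem.
  have iv : index c v < size v by rewrite index_mem.
  rewrite Ew size_cat /= !nth_cat iu ltnn subnn /=.
  have -> : ((size u).+1 + index c v < size u) = false by lia.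
  have -> : (size u).+1 + index c v - size u = (index c v).+1 by lia.
  rewrite /= !nth_index // ac.
  have : c < b + n.
    by have := perm_mem puv c; rewrite mem_cat cv orbT mem_iota => /esym/andP[].
  by move=> -> H; have /negP := H isT ltac:(lia) ltac:(lia); apply.
have sn : size u + size v = n by rewrite -size_cat (perm_size puv) size_iota.
(* In this order the two sorted words form a sorted permutation of the interval; cutting it after
   [size v] letters identifies each part. *)
have Es : sort leq v ++ sort leq u = iota b n.
  apply: (sorted_eq leq_trans anti_leq).
  - rewrite (sorted_pairwise leq_trans) pairwise_cat -!(sorted_pairwise leq_trans).
    rewrite !sort_sorted; try exact: leq_total.
    rewrite !andbT; apply/allrelP => c a; rewrite !mem_sort => cv au.
    exact/ltnW/uv.
  - exact: iota_sorted.
  - apply: (perm_trans (y := u ++ v)) => //; rewrite perm_sym perm_catC perm_sym.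
    by apply: perm_cat; rewrite perm_sort.
have {}Es : (sort leq v == iota b (size v)) && (sort leq u == iota (b + size v) (size u)).
  by rewrite -eqseq_cat ?size_sort ?size_iota // Es -sn addnC iotaD.
case/andP: Es => /eqP Ev /eqP Eu.
have av_v : av132 v.
  move=> i j l ij jl lv; have := aw ((size u).+1 + i) ((size u).+1 + j) ((size u).+1 + l).
  rewrite Ew size_cat !nth_cat /=.
  have E x : ((size u).+1 + x < size u) = false by lia.
  have E' x : (size u).+1 + x - size u = x.+1 by lia.
  by rewrite !E !E' /=; apply; lia.
have av_u : av132 u.
  move=> i j l ij jl lu; have := aw i j l ij jl; rewrite Ew size_cat !nth_cat lu.
  by rewrite !(ltn_trans _ lu) ?(ltn_trans ij) //; apply; lia.
have [||r nr Er] := IH (size v) _ b v _ av_v; first by lia.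
  by rewrite -Ev perm_sym perm_sort.
have [||l nl El] := IH (size u) _ (b + size v) u _ av_u; first by lia.
  by rewrite -Eu perm_sym perm_sort.
exists (Node l r); first by rewrite /= nl nr sn.
by rewrite /= nl nr sn Ew El Er -Er -El.
Qed.

(* [f] is fuel: the list is complete as soon as [n < f]. *)
Fixpoint trees_upto f n : seq btree :=
  if f is f'.+1 then
    if n is n'.+1 then
      flatten [seq [seq Node l r | l <- trees_upto f' i, r <- trees_upto f' (n' - i)]
              | i <- iota 0 n'.+1]
    else [:: Leaf]
  else [::].

Lemma mem_trees_upto f n t : n < f -> (t \in trees_upto f n) = (nodes t == n).
Proof.
elim: f n t => // f IH [|n] t nf; first by rewrite inE; apply/eqP/eqP => [->|]; case: t.
apply/flatten_mapP/eqP => [[i]|].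
  rewrite mem_iota => hi /allpairsP[[l r] /= [hl hr ->]] /=.
  by move: hl hr; rewrite !IH; lia.
case: t => // l r [E]; exists (nodes l); first by rewrite mem_iota; lia.
by apply/allpairsP; exists (l, r); split=> //=; rewrite IH; lia.
Qed.

(** The number of nodes of the left subtree separates the blocks of the list. *)
Lemma uniq_trees_upto f n : n < f -> uniq (trees_upto f n).
Proof.
elim: f n => // f IH [|n] nf //.
set T := fun i => [seq Node l r | l <- trees_upto f i, r <- trees_upto f (n - i)].
have -> : trees_upto f.+1 n.+1 = [seq t | i <- iota 0 n.+1, t <- T i].
  by rewrite /allpairs_dep /=; congr (_ ++ flatten _); rewrite ?map_id //;
    apply: eq_map => i; rewrite map_id.
have hd i t : i < n.+1 -> t \in T i -> exists l r, t = Node l r /\ nodes l = i.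
  move=> hi /allpairsP[[l r] /= [hl hr ->]]; exists l, r; split=> //.
  by apply/eqP; rewrite -(@mem_trees_upto f) //; lia.
apply: allpairs_uniq_dep.
- exact: iota_uniq.
- move=> i; rewrite mem_iota => hi; apply: allpairs_uniq; try by apply: IH; lia.
  by move=> [a b] [c d] _ _ [-> ->].
move=> p q /allpairsPdep[i [t [hi ht ->]]] /allpairsPdep[j [t' [hj ht' ->]]] /= E.
subst t'; rewrite !mem_iota in hi hj.
have [l [r [Et hl]]] := hd i t hi ht; have [l' [r' [Et' hl']]] := hd j t hj ht'.
by move: Et'; rewrite {1}Et => -[El _]; suff -> : i = j; rewrite // -hl -hl' El.
Qed.

(** * Permutations as words *)

Definition perm_seq n (pi : 'S_n) : seq nat := [seq val (pi i) | i <- enum 'I_n].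

Lemma sorted_enum_ord n : sorted (relpre val ltn) (enum 'I_n).
Proof. by rewrite -sorted_map val_enum_ord iota_ltn_sorted. Qed.

Lemma subseq_enum_ord n (s : seq 'I_n) :
  sorted (relpre val ltn) s -> subseq s (enum 'I_n).
Proof.
move=> ss; apply/(subseq_uniqP (enum_uniq _)).
have tr : transitive (relpre val ltn : rel 'I_n) by move=> ? ? ?; apply: ltn_trans.
apply: (irr_sorted_eq tr) => //.
- by move=> ? /=; rewrite ltnn.
- apply: sorted_filter => //; exact: sorted_enum_ord.
- by move=> x; rewrite mem_filter mem_enum andbT.
Qed.

(** An occurrence is encoded by its positions, a subsequence of [enum 'I_n]; for the identity
    pattern the condition left is that the values increase along it. *)
Lemma card_occurrences_increasing k n (pi : 'S_n) :
  #|occurrences (increasing_pattern k) pi| = incr_count k (perm_seq pi).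
Proof.
pose g (f : {ffun 'I_k -> 'I_n}) := [seq f a | a <- enum 'I_k].
rewrite cardE -(size_map g) /incr_count /perm_seq -map_subseqs count_map -size_filter.
apply: perm_size; apply: uniq_perm.
- rewrite map_inj_uniq ?enum_uniq // => f f' E; apply/ffunP => a.
  by move/eq_in_map: E => /(_ a); rewrite mem_enum => /(_ isT).
- by rewrite filter_uniq // uniq_subseqs // enum_uniq.
have tr : transitive (relpre val ltn : rel 'I_k) by move=> ? ? ?; apply: ltn_trans.
move=> s; rewrite mem_filter mem_subseqs; apply/mapP/idP => [[f]|].
  rewrite mem_enum inE => /andP[/forallP h1 /forallP h2 ->].
  rewrite /= size_map size_map size_enum_ord eqxx /= sorted_map sorted_map.
  apply/andP; split.
    apply: sub_sorted (sorted_enum_ord k) => a b /= ab.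
    by have /forallP /(_ b) := h2 a; rewrite !perm1 ab => /eqP.
  apply: subseq_enum_ord; rewrite sorted_map.
  apply: sub_sorted (sorted_enum_ord k) => a b /= ab.
  by have /forallP /(_ b) := h1 a; rewrite ab.
move=> /andP[/= /andP[]]; rewrite size_map => sk ps /subseq_sorted H.
have {H} ss : sorted (relpre val ltn) s.
  by apply: H; [move=> ? ? ?; apply: ltn_trans | exact: sorted_enum_ord].
exists [ffun a => tnth (Tuple sk) a]; last first.
  rewrite /g (eq_map (g := tnth (Tuple sk))); first by rewrite map_tnth_enum.
  by move=> a; rewrite ffunE.
have in_s (a : 'I_k) : nat_of_ord a \in [pred i | i < size s].
  by rewrite inE (eqP sk).
have m1 (a b : 'I_k) : a < b -> tnth (Tuple sk) a < tnth (Tuple sk) b.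
  move=> ab; have x0 := tnth (Tuple sk) a; rewrite !(tnth_nth x0) /=.
  apply: (sorted_ltn_nth (leT := relpre val ltn)) => //.
  by move=> ? ? ?; apply: ltn_trans.
have m2 (a b : 'I_k) : a < b -> pi (tnth (Tuple sk) a) < pi (tnth (Tuple sk) b).
  move=> ab; have x0 := tnth (Tuple sk) a; rewrite !(tnth_nth x0) /=.
  move: ps; rewrite sorted_map => ps.
  apply: (sorted_ltn_nth (leT := relpre (fun i => val (pi i)) ltn)) => //.
  by move=> ? ? ?; apply: ltn_trans.
rewrite mem_enum inE; apply/andP; split; apply/forallP => a; apply/forallP => b.
  by rewrite !ffunE; apply/implyP/m1.
rewrite !ffunE !perm1; case: (ltngtP a b) => [/m2 -> //|/m2 /ltnW|].
  by rewrite leqNgt => /negPf ->.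
by move/val_inj ->; rewrite ltnn.
Qed.

Lemma size_perm_seq n (pi : 'S_n) : size (perm_seq pi) = n.
Proof. by rewrite size_map size_enum_ord. Qed.

Lemma nth_perm_seq n (pi : 'S_n) (i : 'I_n) : nth 0 (perm_seq pi) i = pi i.
Proof. by rewrite (nth_map i) ?size_enum_ord // nth_ord_enum. Qed.

Lemma avoids132P n (pi : 'S_n) : reflect (av132 (perm_seq pi)) (avoids pattern132 pi).
Proof.
have [p0 p1 p2] := pattern132E.
have Ei (f : 'I_3 -> Prop) : f (inord 0) -> f (inord 1) -> f (inord 2) -> forall a, f a.
  move=> h0 h1 h2 a; rewrite -(inord_val a).
  by case: a => -[|[|[|//]]] /=.
apply: (iffP eqP) => [E i j l ij jl|h].
  rewrite size_perm_seq => ln; apply/negP.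
  pose li := Ordinal ln; pose ji := Ordinal (ltn_trans jl ln).
  pose ii := Ordinal (ltn_trans ij (ltn_trans jl ln)).
  rewrite -[i]/(val ii) -[j]/(val ji) -[l]/(val li) !nth_perm_seq => /andP[h1 h2].
  pose f : {ffun 'I_3 -> 'I_n} :=
    [ffun a : 'I_3 => if a == 0 :> nat then ii else if a == 1 :> nat then ji else li].
  suff : f \in occurrences pattern132 pi by rewrite E inE.
  rewrite inE; apply/andP; split; apply/forallP; apply: (Ei _); apply/forallP; apply: (Ei _);
    rewrite ?p0 ?p1 ?p2 !ffunE !inordK //=; try lia.
apply/setP => f; rewrite inE in_set0; apply/negP => /andP[/forallP h1 /forallP h2].
have l01 : f (inord 0) < f (inord 1).
  by have /forallP /(_ (inord 1)) := h1 (inord 0); rewrite !inordK.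
have l12 : f (inord 1) < f (inord 2).
  by have /forallP /(_ (inord 2)) := h1 (inord 1); rewrite !inordK.
have := h _ _ _ l01 l12; rewrite size_perm_seq !nth_perm_seq ltn_ord => /(_ isT) /negP; apply.
have /forallP /(_ (inord 2)) := h2 (inord 0); rewrite p0 p2 !inordK // => /eqP ->.
by have /forallP /(_ (inord 1)) := h2 (inord 2); rewrite p1 p2 !inordK // => /eqP ->.
Qed.

Lemma perm_seq_inj n : injective (@perm_seq n).
Proof. by move=> pi pi' E; apply/permP => i; apply: val_inj; rewrite /= -!nth_perm_seq E. Qed.

Lemma perm_eq_perm_seq n (pi : 'S_n) : perm_eq (perm_seq pi) (iota 0 n).
Proof.
apply: uniq_perm; last 2 [exact: iota_uniq].
  by rewrite map_inj_uniq ?enum_uniq // => i j /val_inj /perm_inj.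
move=> x; rewrite mem_iota; apply/mapP/idP => [[i _ ->]|/= xn]; first exact: ltn_ord.
by exists (pi^-1%g (Ordinal xn)); rewrite ?mem_enum // permKV.
Qed.

Lemma perm_seq_surj n w : perm_eq w (iota 0 n) -> exists pi : 'S_n, perm_seq pi = w.
Proof.
move=> pw; have sw : size w = n by rewrite (perm_size pw) size_iota.
have uw : uniq w by rewrite (perm_uniq pw) iota_uniq.
have hn (i : 'I_n) : nth 0 w i < n.
  by have := perm_mem pw (nth 0 w i); rewrite mem_nth ?sw // mem_iota => /esym.
pose h (i : 'I_n) := Ordinal (hn i).
have hi : injective h.
  by move=> i j [] /eqP; rewrite nth_uniq ?sw // => /eqP /val_inj.
exists (perm hi); apply: (@eq_from_nth _ 0); rewrite size_perm_seq ?sw // => i ni.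
by rewrite -[i]/(val (Ordinal ni)) nth_perm_seq permE.
Qed.

Definition trees n := trees_upto n.+1 n.

Lemma mem_trees n t : (t \in trees n) = (nodes t == n).
Proof. exact: mem_trees_upto. Qed.

Lemma perm_trees_upto f n : n < f -> perm_eq (trees_upto f n) (trees n).
Proof.
move=> nf; apply: uniq_perm; rewrite ?uniq_trees_upto // => t.
by rewrite mem_trees mem_trees_upto.
Qed.

(** Permutations and trees both inject into words; the two resulting duplicate-free lists have the
    same members. *)
Lemma num_av132E m r n :
  num_av132 m.+1 r n = count (fun t => tree_weight m 0 t == r) (trees n).
Proof.
rewrite /num_av132 cardE -(size_map (@perm_seq n)) -size_filter.
rewrite -(size_map (tree_word 0)); apply: perm_size; apply: uniq_perm.
- by rewrite map_inj_uniq ?enum_uniq //; exact: perm_seq_inj.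
- by rewrite map_inj_uniq ?filter_uniq ?uniq_trees_upto //; exact: tree_word_inj.
move=> w; apply/mapP/mapP => [[pi]|[t]].
  rewrite mem_enum inE card_occurrences_increasing => /andP[/avoids132P av_pi].
  have [t nt Et] := tree_word_surj (perm_eq_perm_seq pi) av_pi.
  rewrite Et incr_count_tree_word => ht ->; exists t => //.
  by rewrite mem_filter ht mem_trees nt eqxx.
rewrite mem_filter mem_trees => /andP[/eqP ht /eqP nt ->].
have [pi Epi] : exists pi : 'S_n, perm_seq pi = tree_word 0 t.
  by apply: perm_seq_surj; rewrite -nt perm_tree_word.
exists pi => //; rewrite mem_enum inE card_occurrences_increasing Epi incr_count_tree_word ht eqxx.
by rewrite andbT; apply/avoids132P; rewrite Epi; exact: av132_tree_word.
Qed.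

Lemma sum_trees0 (R : nmodType) (F : btree -> R) :
  (\sum_(t <- trees 0) F t = F Leaf)%R.
Proof. by rewrite big_seq1. Qed.

Lemma sum_treesS (R : nmodType) (F : btree -> R) n :
  (\sum_(t <- trees n.+1) F t =
   \sum_(i < n.+1) \sum_(l <- trees i) \sum_(r <- trees (n - i)) F (Node l r))%R.
Proof.
rewrite [trees _]/trees -[trees_upto _ _]/(flatten _) big_flatten big_map.
rewrite -[iota 0 n.+1]/(index_iota 0 n.+1) big_mkord; apply: eq_bigr => i _.
rewrite big_allpairs_dep (perm_big _ (perm_trees_upto (ltn_ord i))).
have ni : n - i < n.+1 by rewrite ltnS leq_subr.
by apply: eq_bigr => l _; rewrite (perm_big _ (perm_trees_upto ni)).
Qed.

(** * The continued fraction *)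

Import GRing.Theory.
Local Open Scope ring_scope.

(* The denominators of the continued fraction 1 / (1 - x / (1 - ...)):
   [U_n(1 / (2 sqrt x)) = chebV x n / sqrt x ^ n]. *)
Fixpoint chebV (R : comNzRingType) (x : R) n : R :=
  if n is n'.+1 then if n' is n''.+1 then chebV x n' - x * chebV x n'' else 1 else 1.

Lemma chebVSS (R : comNzRingType) (x : R) n : chebV x n.+2 = chebV x n.+1 - x * chebV x n.
Proof. by []. Qed.

(** Carries [chebV] through the embedding into two variables, the substitution of [X^2], the passage
    to fractions and the evaluation at 0. *)
Lemma rmorph_chebV (R S : comNzRingType) (f : {rmorphism R -> S}) x n :
  f (chebV x n) = chebV (f x) n.
Proof.
suff : f (chebV x n) = chebV (f x) n /\ f (chebV x n.+1) = chebV (f x) n.+1 by case.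
elim: n => [|n [IH1 IH2]]; first by rewrite /= rmorph1.
by split=> //; rewrite !chebVSS rmorphB rmorphM IH1 IH2.
Qed.

(** * Congruences modulo powers of x and q *)

Section Ideal.
Variables (R : comNzRingType) (N : nat).
Implicit Types F G : {poly {poly R}}.

(* Membership in the ideal [(x^N, q^D)], with [x] the outer and [q] the inner variable. *)
Definition vanish D F := forall j i, (j < N)%N -> (i < D)%N -> F`_j`_i = 0.

Lemma vanish0 D : vanish D 0.
Proof. by move=> j i _ _; rewrite !coef0. Qed.

Lemma vanishD D F G : vanish D F -> vanish D G -> vanish D (F + G).
Proof. by move=> hF hG j i jN iD; rewrite !coefD hF // hG // addr0. Qed.

Lemma vanishM D F G : vanish D F -> vanish D (G * F).
Proof.
move=> hF j i jN iD; rewrite coefM coef_sum big1 // => a _.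
rewrite coefM big1 // => b _; rewrite hF ?mulr0 //.
  exact: leq_ltn_trans (leq_subr _ _) jN.
exact: leq_ltn_trans (leq_subr _ _) iD.
Qed.

Lemma vanish_sum (I : Type) (s : seq I) (F : I -> {poly {poly R}}) D :
  (forall i, vanish D (F i)) -> vanish D (\sum_(i <- s) F i).
Proof. by move=> h; apply: big_ind => // *; [exact: vanish0 | exact: vanishD]. Qed.

Lemma vanish_le D D' F : (D' <= D)%N -> vanish D F -> vanish D' F.
Proof. by move=> h hF j i jN iD; apply: hF => //; apply: leq_trans h. Qed.

(** A factor [q^c] gains [c] orders of precision in [q]; this lets the expansions below be
    truncated. *)
Lemma vanish_qX D c F : vanish D F -> vanish (D + c) ('X%:P ^+ c * F).
Proof.
move=> hF j i jN iD; rewrite -polyC_exp coefCM coefXnM.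
by case: ltnP => // ci; apply: hF => //; rewrite ltn_subLR // addnC.
Qed.

Lemma vanish_q D F : vanish D ('X%:P ^+ D * F).
Proof. by rewrite -[D]add0n; apply: vanish_qX. Qed.

Lemma vanish_expB1 D F l : vanish D (F - 1) -> vanish D (F ^+ l - 1).
Proof. by move=> h; rewrite subrX1 mulrC; apply: vanishM. Qed.

End Ideal.

(** A division-free truncation of [(1 - z)^(-l) = sum_j C(l + j - 1, j) z^j]. By Pascal's rule,
    multiplying by [1 - z] turns the sum for [l + 1] into the sum for [l], up to a top term. *)
Lemma neg_binomial (R : comNzRingType) (z : R) l n : exists g,
  (\sum_(j < n) 'C(l + j - 1, j)%:R * z ^+ j) * (1 - z) ^+ l = 1 + z ^+ n * g.
Proof.
case: n => [|n]; first by exists (-1); rewrite big_ord0 mul0r expr0; ring.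
elim: l => [|l [g IH]].
  exists 0; rewrite big_ord_recl big1 ?mulr0 ?addr0 => [|i _].
    by rewrite bin0 !mul1r.
  by rewrite bin_small ?mul0r // lift0 add0n subn1.
(* The correction absorbs the top term of [E], multiplied by the remaining [(1 - z)^l]. *)
exists (g - 'C(l + n, n)%:R * (1 - z) ^+ l).
have E : (\sum_(j < n.+1) 'C(l.+1 + j - 1, j)%:R * z ^+ j) * (1 - z) =
  (\sum_(j < n.+1) 'C(l + j - 1, j)%:R * z ^+ j) - 'C(l + n, n)%:R * z ^+ n.+1.
  elim: {g IH} n => [|n IH]; first by rewrite !big_ord1 !bin0 expr0; ring.
  rewrite big_ord_recr /= mulrDl IH [in RHS]big_ord_recr /=.
  rewrite !addSn !subn1 /= addnS /= binS natrD exprS [z ^+ n.+2]exprS.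
  rewrite [z ^+ n.+1]exprS; ring.
by rewrite exprS mulrA E mulrBl IH; ring.
Qed.

(** * Generating functions of forests *)

Definition treeGF m d n : {poly rat} := \sum_(t <- trees n) 'X^(tree_weight m d t).

Lemma treeGF0 m d : treeGF m d 0 = 1.
Proof. by rewrite /treeGF sum_trees0. Qed.

Lemma treeGFS m d n : treeGF m d n.+1 =
  'X^'C(d, m) * \sum_(i < n.+1) treeGF m d.+1 i * treeGF m d (n - i).
Proof.
rewrite /treeGF sum_treesS mulr_sumr; apply: eq_bigr => i _.
rewrite mulr_suml mulr_sumr; apply: eq_bigr => l _.
rewrite mulrA mulr_sumr; apply: eq_bigr => r _.
by rewrite /= !exprD.
Qed.

Lemma coef_treeGF m r n : (treeGF m 0 n)`_r = (num_av132 m.+1 r n)%:R.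
Proof.
rewrite num_av132E /treeGF coef_sum -sum1_count natr_sum big_mkcond /=.
rewrite [RHS]big_mkcond /=; apply: eq_bigr => t _.
by rewrite coefXn eq_sym; case: eqP.
Qed.

Section Continued.
Variables (N m : nat).

(** A truncation in [x] stands for the power series P_d over Q[q], so its identities hold only
    modulo [x^N]. *)
Definition forestGF d : {poly {poly rat}} := \poly_(n < N) treeGF m d n.

Local Notation P := forestGF.
Local Notation q := ('X%:P : {poly {poly rat}}).
Local Notation x := ('X : {poly {poly rat}}).
Local Notation y d := (x * q ^+ 'C(d, m)).

(** The root decomposition [treeGFS] reads P_d = 1 + y_d P_(d+1) P_d. It is exact in [q], whence the
    arbitrary [D]. *)
Lemma forestGF_rec D d : vanish N D (P d * (1 - y d * P d.+1) - 1).
Proof.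
have -> : P d * (1 - y d * P d.+1) - 1 =
    P d - x * (q ^+ 'C(d, m) * (P d.+1 * P d)) - 1 by ring.
move=> j i jN iD; suff -> : (P d - x * (q ^+ 'C(d, m) * (P d.+1 * P d)) - 1)`_j = 0.
  by rewrite coef0.
rewrite !coefB coefXM coef1 coef_poly jN; case: j jN => [|j] jN /=.
  by rewrite treeGF0; ring.
rewrite -polyC_exp coefCM coefM treeGFS mulr0n subr0; apply/eqP; rewrite subr_eq0; apply/eqP.
congr (_ * _); apply: eq_bigr => a _; rewrite !coef_poly.
by have /andP[-> ->] : (a < N)%N && (j - a < N)%N by have := ltn_ord a; lia.
Qed.

(* [c] is [chebV x d.-1], or 0 if [d = 0]; the second equation is Cassini's identity. *)
Lemma forestGF_convergent D d : (d <= m)%N -> exists c,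
  [/\ chebV x d - x * c = chebV x d.+1, chebV x d ^+ 2 - c * chebV x d.+1 = x ^+ d
    & vanish N D (P 0 * (chebV x d.+1 - y d * chebV x d * P d.+1)
                  - (chebV x d - y d * c * P d.+1))].
Proof.
elim: d => [|d IH] dm.
  exists 0; split; [by rewrite /=; ring..|].
  rewrite (_ : _ - _ = P 0 * (1 - y 0 * P 1) - 1); last by rewrite /=; ring.
  exact: forestGF_rec.
have [c [h1 h2 h3]] := IH (ltnW dm); exists (chebV x d); split.
- by rewrite chebVSS.
- by rewrite chebVSS [x ^+ d.+1]exprS -h2 -h1; ring.
(* Above depth [m] the nodes have weight 0, so [q] does not appear yet. *)
move: h3; rewrite bin_small // expr0 mulr1 => h3.
(* This substitutes P_(d+1) = 1 / (1 - y_(d+1) P_(d+2)) without dividing: the relation for [d] is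
   multiplied by that denominator and corrected by a multiple of the recursion. *)
rewrite (_ : _ - _ =
  (1 - y d.+1 * P d.+2) * (P 0 * (chebV x d.+1 - x * chebV x d * P d.+1) - (chebV x d - x * c * P d.+1))
  + (x * (chebV x d * P 0 - c)) * (P d.+1 * (1 - y d.+1 * P d.+2) - 1)).
  by apply: vanishD; apply: vanishM => //; exact: forestGF_rec.
by rewrite chebVSS -h1; ring.
Qed.

(* With [A = chebV x m.+1], [a = chebV x m] and [z = x q P_(m+1)], Cassini's identity
   turns [P_0 (A - a z) = a - c z] into [A P_0 (A - a z) = a (A - a z) + x^m z]. *)
Lemma forestGF_geometric r :
  vanish N r.+1 (chebV x m.+1 ^+ r.+2 * P 0 - (chebV x m * chebV x m.+1 ^+ r.+1 +
    x ^+ m * \sum_(i < r.+1) chebV x m.+1 ^+ (r - i) * chebV x m ^+ i * (x * q * P m.+1) ^+ i.+1)).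
Proof.
have [c [_ h2]] := forestGF_convergent r.+1 (leqnn m).
rewrite binn expr1 => h3.
set z := x * q * P m.+1; set A := chebV x m.+1; set a := chebV x m.
set S := \sum_(i < r.+1) A ^+ (r - i) * (a * z) ^+ i.
have ES : \sum_(i < r.+1) A ^+ (r - i) * a ^+ i * z ^+ i.+1 = z * S.
  by rewrite mulr_sumr; apply: eq_bigr => i _;
    rewrite [(a * z) ^+ i]exprMn [z ^+ i.+1]exprS -mulrA [RHS]mulrCA [z * (_ * _)]mulrCA.
have EX : A ^+ r.+1 - (a * z) ^+ r.+1 = (A - a * z) * S by rewrite subrXX.
(* The first term is a multiple of the convergent relation; the second is the tail of the geometric
   series, divisible by [q^(r+1)]. *)
rewrite ES (_ : _ - _ = A * S * (P 0 * (A - x * q * a * P m.+1) - (a - x * q * c * P m.+1))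
   + (A * P 0 - a) * (q ^+ r.+1 * (a * (x * P m.+1)) ^+ r.+1)).
  by apply: vanishD; apply: vanishM => //; exact: vanish_q.
have EZ : q ^+ r.+1 * (a * (x * P m.+1)) ^+ r.+1 = A ^+ r.+1 - (A - a * z) * S.
  by rewrite -EX subKr -exprMn; congr (_ ^+ _); rewrite /z; ring.
rewrite EZ -h2 [A ^+ r.+2]exprS -/A -/a; move: (A ^+ r.+1) => B; rewrite /z; ring.
Qed.

(** * Powers of P_d expanded over level sizes *)

Fixpoint bounded_seqs r D : seq (seq nat) :=
  if D is D'.+1 then [seq j :: s | j <- iota 0 r.+1, s <- bounded_seqs r D'] else [:: [::]].

(** Since [C(l + j - 1, j)] counts the distributions of [j] children among [l] parents, this counts
    the forests on [l] given roots whose further level sizes are [s]. *)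
Fixpoint binom_chain l s : nat :=
  if s is j :: s' then 'C(l + j - 1, j) * binom_chain j s' else 1.

Fixpoint seq_weight d s : nat :=
  if s is j :: s' then (j * 'C(d, m) + seq_weight d.+1 s')%N else 0.

(** The expansion of P_d^l: [l] parents at depth [d - 1], with [s] listing the level sizes from
    depth [d] on. *)
Definition seqGF r D d l : {poly {poly rat}} :=
  \sum_(s <- bounded_seqs r D) (binom_chain l s)%:R * x ^+ sumn s * q ^+ seq_weight d s.

Lemma seqGFS r D d l : seqGF r D.+1 d l =
  \sum_(j < r.+1) 'C(l + j - 1, j)%:R * y d ^+ j * seqGF r D d.+1 j.
Proof.
rewrite /seqGF big_allpairs_dep -[iota 0 r.+1]/(index_iota 0 r.+1) big_mkord.
apply: eq_bigr => j _; rewrite mulr_sumr; apply: eq_bigr => s _.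
by rewrite /= natrM !exprD exprMn -exprM [('C(d, m) * j)%N]mulnC; ring.
Qed.

Lemma seqGF0 r D d : seqGF r D d 0 = 1.
Proof.
elim: D d => [|D IH] d; first by rewrite /seqGF big_seq1 /=; ring.
rewrite seqGFS big_ord_recl big1 => [|i _]; first by rewrite IH bin0; ring.
by rewrite bin_small ?mul0r // lift0 add0n subn1.
Qed.

(** P_d^l = (1 - z)^(-l) is expanded by the negative binomial series. A term with [j > 0] carries a
    positive power of [q], so P_(d+1)^j is needed to one order less, and [D] levels give precision
    [q^D]. *)
Lemma forestGF_exp r D d l : (D <= r.+1)%N -> (m <= d)%N ->
  vanish N D (P d ^+ l - seqGF r D d l).
Proof.
elim: D d l => [|D IH] d l Dr md; first by [].
pose z := y d * P d.+1.
have [g Eg] := neg_binomial z l r.+1.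
set S := \sum_(j < r.+1) _ in Eg.
have c0 : (0 < 'C(d, m))%N by rewrite bin_gt0.
have h1 : vanish N D.+1 (P d ^+ l - S).
  (* Both P_d^l and [S] invert [(1 - z)^l] up to an error that vanishes. *)
  have -> : P d ^+ l - S = S * ((P d * (1 - z)) ^+ l - 1) + - (P d ^+ l * g) * z ^+ r.+1.
    have -> : - (P d ^+ l * g) * z ^+ r.+1 = - P d ^+ l * (S * (1 - z) ^+ l - 1) by rewrite Eg; ring.
    by rewrite [(P d * _) ^+ l]exprMn; ring.
  apply: vanishD; apply: vanishM; first by apply: vanish_expB1; exact: forestGF_rec.
  rewrite /z exprMn [y d]mulrC exprMn -exprM -!mulrA.
  by apply: (@vanish_le _ _ ('C(d, m) * r.+1)); [nia | exact: vanish_q].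
rewrite (_ : _ - _ = (P d ^+ l - S) + (S - seqGF r D.+1 d l)); last by ring.
apply: vanishD => //; rewrite seqGFS -sumrB; apply: vanish_sum => j.
(* The term [j = 0] gains no power of [q], but there both sides are exactly 1. *)
rewrite /z exprMn; set C := _%:R; case: j @C => -[|j] hj C.
  by rewrite /= seqGF0 !expr0 (_ : _ - _ = 0); [exact: vanish0 | ring].
rewrite (_ : _ - _ = C * x ^+ j.+1 * (q ^+ ('C(d, m) * j.+1) * (P d.+1 ^+ j.+1 - seqGF r D d.+1 j.+1))).
  apply: vanishM; apply: (@vanish_le _ _ (D + 'C(d, m) * j.+1)); first by nia.
  by apply: vanish_qX; apply: IH; [exact: ltnW | exact: leqW].
by rewrite /= exprMn exprM; ring.
Qed.

End Continued.

(* The forest has [i.+1] nodes at depth [m], and [s] lists the deeper levels. *)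
Definition numer_term m r i s : {poly rat} :=
  (binom_chain i.+1 s)%:R *
    (chebV 'X m.+1 ^+ (r - i) * chebV 'X m ^+ i * 'X ^+ (m + i.+1 + sumn s)).

(** The numerator over the denominator [chebV 'X m.+1 ^+ r.+2]; the filter keeps the terms of degree
    [r] in [q], each node at depth [m] having weight 1. *)
Definition numer m r : {poly rat} :=
  \sum_(i < r.+1) \sum_(s <- bounded_seqs r r.+1 | (i.+1 + seq_weight m m.+1 s == r)%N)
    numer_term m r i s.

(** * Extraction of the coefficient of q^r *)

Local Notation lift := (map_poly (polyC : rat -> {poly rat})).

Lemma coef_lift_qX (g : {poly rat}) e n r :
  (lift g * 'X%:P ^+ e)`_n`_r = if e == r then g`_n else 0.
Proof.
rewrite -polyC_exp coefMC coef_map /= coefCM coefXn eq_sym.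
by case: eqP => _; rewrite ?mulr1 ?mulr0.
Qed.

Lemma coef_liftM (g : {poly rat}) F n r :
  (lift g * F)`_n`_r = \sum_(i < n.+1) g`_i * F`_(n - i)`_r.
Proof.
rewrite coefM coef_sum; apply: eq_bigr => i _.
by rewrite coef_map /= coefCM.
Qed.

Lemma numer_coef m r n : (0 < r)%N ->
  \sum_(i < n.+1) (chebV 'X m.+1 ^+ r.+2)`_i * (num_av132 m.+1 r (n - i))%:R
  = (numer m r)`_n.
Proof.
move=> r0; have EV d : chebV 'X d = lift (chebV 'X d) by rewrite rmorph_chebV /= map_polyX.
set G := chebV 'X m * chebV 'X m.+1 ^+ r.+1 +
  \sum_(i < r.+1) \sum_(s <- bounded_seqs r r.+1)
     lift (numer_term m r i s) * 'X%:P ^+ (i.+1 + seq_weight m m.+1 s).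
have h : vanish n.+1 r.+1 (chebV 'X m.+1 ^+ r.+2 * forestGF n.+1 m 0 - G).
  have := @forestGF_geometric n.+1 m r.
  set S := \sum_(i < r.+1) _; set K := \sum_(i < r.+1) _ in G * => h1.
  rewrite (_ : _ - G = (chebV 'X m.+1 ^+ r.+2 * forestGF n.+1 m 0 -
    (chebV 'X m * chebV 'X m.+1 ^+ r.+1 + 'X ^+ m * S)) + ('X ^+ m * S - K)); last first.
    by rewrite /G; ring.
  apply: vanishD => //; rewrite mulr_sumr -sumrB; apply: vanish_sum => i.
  pose c : {poly {poly rat}} :=
    'X ^+ m * (chebV 'X m.+1 ^+ (r - i) * chebV 'X m ^+ i * ('X * 'X%:P) ^+ i.+1).
  rewrite (_ : _ - _ = c * (forestGF n.+1 m m.+1 ^+ i.+1 - seqGF m r r.+1 m.+1 i.+1)).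
    by apply: vanishM; exact: forestGF_exp.
  rewrite mulrBr /seqGF [c * \sum_(_ <- _) _]mulr_sumr; congr (_ - _).
    by rewrite /c [in LHS]exprMn !mulrA.
  apply: eq_bigr => s _; rewrite /numer_term /c !EV !rmorphM !rmorphXn /= map_polyX.
  by rewrite rmorph_nat exprMn !exprD; ring.
have := h n r (ltnSn n) (ltnSn r); rewrite !coefB => /eqP; rewrite subr_eq0 => /eqP.
rewrite EV -rmorphXn coef_liftM => E.
transitivity (G`_n`_r).
  rewrite -E; apply: eq_bigr => i _; rewrite coef_poly ltnS leq_subr.
  by rewrite coef_treeGF.
(* The first summand of [G] is free of [q], so it does not contribute to [q^r] for [r > 0]. *)
rewrite /G !EV -rmorphXn -rmorphM !coefD coef_map coefC /= -[r == 0%N]negbK -lt0n r0 add0r.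
rewrite !coef_sum; apply: eq_bigr => i _; rewrite !coef_sum [RHS]big_mkcond /=.
by apply: eq_bigr => s _; exact: coef_lift_qX.
Qed.

(** Substituting [X^2] spreads the coefficients over the even indices, exactly as [series_in_x]
    does. *)
Lemma is_expansion_sqr (a : nat -> nat) (p q : {poly rat}) F :
  q != 0 ->
  F = FracField.tofrac (p \Po 'X^2) / FracField.tofrac (q \Po 'X^2) ->
  (forall n, \sum_(i < n.+1) q`_i * (a (n - i)%N)%:R = p`_n) ->
  is_expansion (series_in_x a) F.
Proof.
move=> q0 EF h; exists (p \Po 'X^2), (q \Po 'X^2); split => //.
  by rewrite comp_poly_eq0 ?size_polyXn.
(* Only coefficients up to [n] matter, so a polynomial replaces the series. *)
move=> n; pose f : {poly rat} := \poly_(i < n.+1) (a i)%:R.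
transitivity ((q * f) \Po 'X^2)`_n.
  rewrite comp_polyM coefM; apply: eq_bigr => i _; congr (_ * _).
  rewrite coef_comp_poly_Xn // /series_in_x dvdn2 coef_poly divn2.
  case: odd => //=; case: ltnP => //; lia.
rewrite !coef_comp_poly_Xn //; case: ifP => // _.
rewrite -h coefM; apply: eq_bigr => i _; rewrite coef_poly.
have -> // : (n %/ 2 - i < n.+1)%N by have := ltn_ord i; lia.
Qed.

(** * The sum over the sequences [l] *)

From mathcomp Require Import boolp classical_sets functions cardinality fsbigop.
From mathcomp Require Import finmap.

Local Open Scope ring_scope.
Local Open Scope classical_set_scope.

(** * Chebyshev polynomials in the field of rational functions *)

Lemma sqrtx_neq0 : sqrtx != 0.
Proof. by rewrite /sqrtx tofrac_eq0 polyX_eq0. Qed.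

Lemma tofrac_chebV d :
  FracField.tofrac (chebV 'X d \Po 'X^2) = chebV xvar d :> ratfun.
Proof.
rewrite /xvar /sqrtx -rmorphXn -rmorph_chebV; congr FracField.tofrac.
by rewrite (rmorph_chebV (comp_poly 'X^2)) /= comp_polyX.
Qed.

(** The constant coefficient is 1. *)
Lemma chebV_neq0 d : chebV ('X : {poly rat}) d != 0.
Proof.
suff : (chebV ('X : {poly rat}) d).[0] != 0.
  by apply: contra_neq => ->; rewrite horner0.
rewrite -[X in X != _]/(horner_eval 0 _) rmorph_chebV /= /horner_eval hornerX.
suff -> : chebV (0 : rat) d = 1 by rewrite oner_neq0.
elim: d => // -[|d] // IH; by rewrite chebVSS IH mul0r subr0.
Qed.

Lemma chebV_xvar_neq0 d : chebV xvar d != 0.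
Proof.
rewrite -tofrac_chebV tofrac_eq0 comp_poly_eq0 ?chebV_neq0 //.
by rewrite size_polyXn.
Qed.

(** At [u = 1 / (2 s)] the factor [2 u] is [1 / s], and clearing powers of [s] turns one recurrence
    into the other. *)
Lemma horner_chebU (K : fieldType) (s : K) d : 2%:R != 0 :> K -> s != 0 ->
  (chebU K d).[(2%:R * s)^-1] = chebV (s ^+ 2) d / s ^+ d.
Proof.
move=> n2 s0; set u := _^-1.
have Eu : u *+ 2 = s^-1 by rewrite -mulr_natl /u; field; rewrite s0.
suff : (chebU K d).[u] = chebV (s ^+ 2) d / s ^+ d /\
       (chebU K d.+1).[u] = chebV (s ^+ 2) d.+1 / s ^+ d.+1 by case.
elim: d => [|d [IH1 IH2]].
  by rewrite /= hornerC hornerMn hornerX Eu expr0 expr1 divr1 mul1r.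
split=> //; rewrite chebUSS hornerD hornerN hornerM hornerMn hornerX Eu IH1 IH2 chebVSS.
by rewrite !exprS; field; rewrite s0 expf_neq0.
Qed.

Lemma U_atE d : U_at d = chebV xvar d / sqrtx ^+ d.
Proof.
apply: horner_chebU sqrtx_neq0.
by rewrite -(rmorph_nat (@FracField.tofrac _)) tofrac_eq0 -polyC_natr polyC_eq0.
Qed.

(** Apart from [t], the exponents of [s] add up to [(m+1)(i+2) - m i + i = 2 (m+i+1)], so only
    integral powers of [x] remain. *)
Lemma cheb_ratio_exp (K : fieldType) (b s v w : K) m i t : s != 0 -> w != 0 ->
  b * ((v / s ^+ m) ^+ i / (w / s ^+ m.+1) ^+ i.+2) * (s ^+ i * (s ^+ 2) ^+ t)
  = b * (v ^+ i * (s ^+ 2) ^+ (m + i.+1 + t)) / w ^+ i.+2.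
Proof.
move=> s0 w0; rewrite !expr_div_n -!exprM mulnDr exprD.
have -> : s ^+ (2 * (m + i.+1)) = s ^+ (m.+1 * i.+2) * s ^+ i / s ^+ (m * i).
  apply: (canRL (mulfK _)); first by rewrite expf_neq0.
  by rewrite -!exprD; congr (_ ^+ _); lia.
by field; rewrite !expf_neq0.
Qed.

Lemma summandE m i l : l 0%N = i.+1 ->
  summand m.+1 l = (binom_prod l)%:R *
    (chebV xvar m ^+ i * xvar ^+ (m + i.+1 + tail_sum l)) / chebV xvar m.+1 ^+ i.+2.
Proof.
move=> l0; rewrite /summand l0 (_ : i.+1%:Z - 1 = i%:Z); last by rewrite -addn1 PoszD addrK.
by rewrite -!exprnP !U_atE; apply: cheb_ratio_exp (sqrtx_neq0) (chebV_xvar_neq0 _).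
Qed.

Lemma tofrac_numer_term m r i s :
  FracField.tofrac (numer_term m r i s \Po 'X^2) = (binom_chain i.+1 s)%:R *
    (chebV xvar m.+1 ^+ (r - i) * chebV xvar m ^+ i * xvar ^+ (m + i.+1 + sumn s)) :> ratfun.
Proof.
rewrite -!tofrac_chebV /xvar /sqrtx -(rmorph_nat (@FracField.tofrac _)).
rewrite -!rmorphXn -!rmorphM; congr FracField.tofrac.
by rewrite /numer_term !(rmorphM, rmorphXn) /= rmorph_nat comp_polyX.
Qed.

Lemma common_denominator (K : fieldType) (a b c w : K) i r : w != 0 -> (i <= r)%N ->
  a * (b * c) / w ^+ i.+2 = a * (w ^+ (r - i) * b * c) / w ^+ r.+2.
Proof.
move=> w0 ir; have -> : r.+2 = (i.+2 + (r - i))%N by lia.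
by rewrite exprD; field; rewrite !expf_neq0.
Qed.

(** * From finitely supported functions to finite lists *)

Lemma fsbig_nat (T : Type) (idx : T) (op : Monoid.com_law idx) (F : nat -> T) B :
  (forall i, (B <= i)%N -> F i = idx) ->
  \big[op/idx]_(i \in [set: nat]) F i = \big[op/idx]_(0 <= i < B) F i.
Proof.
move=> h; rewrite (fsbigE (index_iota 0 B)) ?iota_uniq //.
  by apply: eq_bigl => i; rewrite in_setT.
by move=> i _; rewrite mem_index_iota -leqNgt => /h.
Qed.

Lemma nth_seq_weight m d w :
  (\sum_(0 <= i < size w) nth 0 w i * 'C(d + i, m))%N = seq_weight m d w.
Proof.
elim: w d => [|a w IH] d; first by rewrite big_nil.
rewrite big_nat_recl //= addn0 -IH; congr (_ + _)%N.
by apply: eq_bigr => i _; rewrite addSnnS.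
Qed.

Lemma nth_binom_chain a s :
  (\prod_(0 <= i < size s) 'C(nth 0 (a :: s) i + nth 0 s i - 1, nth 0 s i))%N
  = binom_chain a s.
Proof.
elim: s a => [|b s IH] a; first by rewrite big_nil.
by rewrite big_nat_recl //= -IH.
Qed.

Lemma binom_prod_nth a s : binom_prod (nth 0%N (a :: s)) = binom_chain a s.
Proof.
rewrite /binom_prod (@fsbig_nat _ _ _ _ (size s)) ?nth_binom_chain //.
by move=> i si; rewrite /= [nth 0%N s i]nth_default // bin0.
Qed.

Lemma tail_sum_nth a s : tail_sum (nth 0%N (a :: s)) = sumn s.
Proof.
rewrite /tail_sum (@fsbig_nat _ _ _ _ (size s)); last first.
  by move=> i si; rewrite /= nth_default.
by rewrite sumnE [RHS](big_nth 0%N).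
Qed.

Lemma mem_bounded_seqs r D s : (s \in bounded_seqs r D) = (size s == D) && all (leq^~ r) s.
Proof.
elim: D s => [|D IH] s; first by rewrite inE; case: s.
apply/allpairsP/idP => [[[j s'] [hj hs ->]]|].
  by move: hj hs; rewrite IH mem_iota /= add0n ltnS eqSS => -> /andP[-> ->].
case: s => // j s; rewrite [X in X -> _]/= eqSS => /and3P[hs hj ha]; exists (j, s); split=> //.
  by rewrite mem_iota /= add0n ltnS.
by rewrite IH hs.
Qed.

Lemma uniq_bounded_seqs r D : uniq (bounded_seqs r D).
Proof.
elim: D => // D IH; apply: allpairs_uniq => //; first exact: iota_uniq.
by move=> [a b] [c d] _ _ [-> ->].
Qed.

(** A finite box of candidates for the sequence ell, padded by zeros through [nth 0], with a
    positive first entry. *)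
Definition pos_seqs r : seq (seq nat) :=
  [seq i.+1 :: s | i <- iota 0 r.+1, s <- bounded_seqs r r.+1].

Lemma pos_seqsP r w :
  reflect (exists i s, [/\ (i <= r)%N, s \in bounded_seqs r r.+1 & w = i.+1 :: s])
          (w \in pos_seqs r).
Proof.
apply: (iffP allpairsP) => [[[i s] [hi hs ->]]|[i [s [hi hs ->]]]].
  by exists i, s; split=> //; move: hi; rewrite mem_iota add0n ltnS.
by exists (i, s); split=> //; rewrite mem_iota add0n ltnS.
Qed.

Lemma size_pos_seqs r w : w \in pos_seqs r -> size w = r.+2.
Proof.
by move=> /pos_seqsP[i [s [_ + ->]]]; rewrite mem_bounded_seqs /= => /andP[/eqP ->].
Qed.

Lemma finite_support_bound (l : nat -> nat) :
  finite_set [set i | l i != 0%N] -> exists B, forall i, (B <= i)%N -> l i = 0%N.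
Proof.
move=> /finite_fsetP[X EX]; exists (\max_(i <- X) i).+1 => i hi.
apply/eqP/negPn/negP => li.
have : [set` X] i by rewrite -EX.
by move=> /= iX; move: hi; rewrite ltnNge (@leq_bigmax_seq _ _ xpredT id).
Qed.

Lemma admissible_nth m r w : w \in pos_seqs r ->
  admissible m.+1 r (nth 0%N w) <-> seq_weight m m w = r.
Proof.
move=> hw; have B0 i : (size w <= i)%N -> nth 0%N w i = 0%N by move=> ?; rewrite nth_default.
rewrite /admissible /= (@fsbig_nat _ _ _ _ (size w)) ?nth_seq_weight; last first.
  by move=> i /B0 ->.
split=> [[]//|->]; split=> //.
apply: (sub_finite_set (B := `I_(size w))) => [i /= li|]; last exact: finite_II.
by rewrite ltnNge; apply: contra li => /B0 ->.
Qed.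

(** For [l i = 0 < l i.+1] the factor [C(l i.+1 - 1, l i.+1)] is 0, so a nonzero product forces the
    support to be an initial segment. *)
Lemma binom_prod_neq0 l i : finite_set [set i | l i != 0%N] ->
  binom_prod l != 0%N -> l i = 0%N -> l i.+1 = 0%N.
Proof.
move=> /finite_support_bound[B hB]; rewrite /binom_prod (@fsbig_nat _ _ _ _ (B)); last first.
  by move=> j hj; rewrite (hB j.+1) ?leqW // bin0.
move=> nz li; have [/hB|iB] := leqP B i.+1; first by [].
apply/eqP/negPn/negP => lj; move/eqP: nz; apply; apply/eqP.
rewrite (big_rem i) /=; last by rewrite mem_index_iota; lia.
by rewrite li add0n bin_small ?mul0n //; lia.
Qed.

Lemma admissible_pos_seqs m r l : (0 < r)%N -> admissible m.+1 r l ->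
  binom_prod l != 0%N ->
  exists2 w, w \in pos_seqs r & l = nth 0%N w.
Proof.
move=> r0 [fl Er] nz.
have step i : l i = 0%N -> l i.+1 = 0%N by exact: binom_prod_neq0.
have up i j : (i <= j)%N -> l i = 0%N -> l j = 0%N.
  by move=> /subnK <-; elim: (j - i)%N => // k IH /IH /step.
(* Each entry is counted with a coefficient [C(m + j, m) >= 1]. *)
have part i : (\sum_(0 <= j < i) l j <= r)%N.
  have [B hB] := finite_support_bound fl.
  rewrite -Er (@fsbig_nat _ _ _ _ (maxn B i)); last first.
    by move=> j hj; rewrite hB //; lia.
  rewrite [X in (_ <= X)%N](big_cat_nat (n := i)) ?leq_maxr //=.
  apply: (@leq_trans (\sum_(0 <= j < i) l j * 'C(m + j, m))%N); last exact: leq_addr.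
  by apply: leq_sum => j _; rewrite leq_pmulr // bin_gt0 leq_addr.
have le i : (l i <= r)%N by apply: leq_trans (part i.+1); rewrite big_nat_recr //= leq_addl.
(* Otherwise [l 0, ..., l i] would be more than [r] positive entries, with sum at most [r]. *)
have big i : (r <= i)%N -> l i = 0%N.
  move=> ri; apply/eqP/negPn/negP => li.
  have : (\sum_(0 <= j < i.+1) 1 <= \sum_(0 <= j < i.+1) l j)%N.
    rewrite !big_seq; apply: leq_sum => j; rewrite mem_index_iota => /andP[_ ji].
    by rewrite lt0n; apply: contra li => /eqP /(up j i) -> //.
  by rewrite sum_nat_const_nat; have := part i.+1; lia.
have l0 : (0 < l 0)%N.
  rewrite lt0n; apply/eqP => l0; move: r0; rewrite -Er fsbig1 // => i _.
  by rewrite (up 0%N i).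
exists (mkseq l r.+2); last first.
  apply: funext => i; have [ir|ir] := ltnP i r.+2; first by rewrite nth_mkseq.
  by rewrite nth_default ?size_mkseq // big //; lia.
apply/pos_seqsP; exists (l 0%N).-1, (mkseq (l \o S) r.+1); split.
- by have := le 0%N; lia.
- by rewrite mem_bounded_seqs size_mkseq eqxx; apply/allP => _ /mapP[i _ ->] /=.
- by rewrite prednK // /mkseq map_comp -(iotaDl 1 0).
Qed.

(** Admissible functions outside the list have a zero binomial product, so the possibly infinite
    index set shrinks to the list. *)
Lemma sum_admissible m r : (0 < r)%N ->
  \sum_(l \in admissible m.+1 r) summand m.+1 l =
  \sum_(w <- pos_seqs r | seq_weight m m w == r) summand m.+1 (nth 0%N w).
Proof.
move=> r0; pose L := [seq nth 0%N w | w <- pos_seqs r & seq_weight m m w == r].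
have LA l : l \in L -> admissible m.+1 r l.
  by case/mapP=> w; rewrite mem_filter => /andP[/eqP cw hw] ->; apply/admissible_nth.
rewrite (fsbigE L) //.
- rewrite big_seq_cond (eq_bigl (fun l => l \in L)); last first.
    by move=> l /=; apply/andb_idr => /LA; rewrite in_setE.
  by rewrite -big_seq big_map big_filter.
- rewrite map_inj_in_uniq.
    apply: filter_uniq; apply: allpairs_uniq; [exact: iota_uniq | exact: uniq_bounded_seqs |].
    by move=> [a b] [c d] _ _ [-> ->].
  (* Padding by zeros is injective on lists of the common length [r.+2]. *)
  move=> w w'; rewrite !mem_filter => /andP[_ /size_pos_seqs hw] /andP[_ /size_pos_seqs hw'] E.
  by apply: (@eq_from_nth _ 0%N); rewrite hw ?hw' // => i _; rewrite E.
move=> l hl lL; rewrite /summand; case: (eqVneq (binom_prod l) 0%N) => [->|nz].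
  by rewrite !mul0r.
have [w hw El] := admissible_pos_seqs r0 hl nz.
move/negP: lL; case; apply/mapP; exists w => //; rewrite mem_filter hw andbT.
by apply/eqP; move: hl; rewrite El => /admissible_nth -> .
Qed.

Theorem theorem3 (k r : nat) (hk : (1 <= k)%N) (hr : (1 <= r)%N) :
  is_expansion (series_in_x (num_av132 k r))
    (\sum_(l \in admissible k r) summand k l).
Proof.
case: k hk => // m _.
(* The exponent [r.+2] suffices as a common denominator: the retained sequences have [ell_1 = i.+1]
   with [i <= r], hence [ell_1 + 1 <= r.+2]. *)
apply: (@is_expansion_sqr _ (numer m r) (chebV 'X m.+1 ^+ r.+2)).
- by rewrite expf_neq0 // chebV_neq0.
- rewrite sum_admissible // /pos_seqs big_mkcond big_allpairs_dep.
  rewrite -[iota 0 _]/(index_iota 0 r.+1) big_mkord /numer.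
  have -> : FracField.tofrac (chebV 'X m.+1 ^+ r.+2 \Po 'X^2) = chebV xvar m.+1 ^+ r.+2 :> ratfun.
    by rewrite -tofrac_chebV -!rmorphXn.
  rewrite (rmorph_sum (comp_poly 'X^2)) (rmorph_sum (@FracField.tofrac _)) mulr_suml.
  apply: eq_bigr => i _.
  rewrite (rmorph_sum (comp_poly 'X^2)) (rmorph_sum (@FracField.tofrac _)) mulr_suml.
  rewrite [RHS]big_mkcond.
  apply: eq_bigr => s _.
  (* As [C(m, m) = 1], the admissibility condition is the filter in [numer]. *)
  rewrite -[seq_weight _ _ _]/(i.+1 * 'C(m, m) + seq_weight m m.+1 s)%N binn muln1; case: eqP => // Er.
  rewrite (@summandE _ i) // binom_prod_nth tail_sum_nth.
  transitivity (FracField.tofrac (numer_term m r i s \Po 'X^2) / chebV xvar m.+1 ^+ r.+2 : ratfun);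
    last by [].
  rewrite tofrac_numer_term.
  by apply: common_denominator (chebV_xvar_neq0 _) _; rewrite -ltnS.
- by move=> n; exact: numer_coef.
Qed.
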